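(* Let $n\ge2$ and $x,y,z,x',y',z'\in C_n$. Then $xyz\ \ddot{\sim}\ x'y'z'$ if and only if $xyz=x'y'z'$ or $xyz,x'y'z'\in\{a1\bar1,\ 1a\bar1,\ 1\bar1a\}$ for some $a\in C_n$.
   Context: Let $n\ge2$ and $C_n=\{1<2<\cdots<n<\bar n<\overline{n-1}<\cdots<\bar 1\}$; $C_n^*$ is the free monoid of words over $C_n$ and $|w|_a$ the number of occurrences of the letter $a$ in $w$. Convention: the symbols $n+1$ and $\overline{n+1}$ never occur in any word. For $i\in\{1,\dots,n\}$, $w$ has an $i$-inversion if $w=w_1xw_2yw_3$ with $x\in\{i,\overline{i+1}\}$, $y\in\{i+1,\bar i\}$. Quasi-crystal structure on $C_n^*$: $\mathrm{wt}(w)=(|w|_1-|w|_{\bar1},\dots,|w|_n-|w|_{\bar n})\in\mathbb{Z}^n$. For $i\in\{1,\dots,n\}$: if $w$ has an $i$-inversion then $\ddot{\varepsilon}_i(w)=\ddot{\varphi}_i(w)=+\infty$ and $\ddot{e}_i(w),\ddot{f}_i(w)$ are undefined; otherwise $\ddot{\varepsilon}_i(w)=|w|_{i+1}+|w|_{\bar i}$, $\ddot{\varphi}_i(w)=|w|_i+|w|_{\overline{i+1}}$; $\ddot{e}_i(w)$ is defined iff $\ddot{\varepsilon}_i(w)>0$ and is obtained by replacing the right-most letter of $w$ lying in $\{i+1,\bar i\}$ by its image ($i+1\mapsto i$, $\bar i\mapsto\overline{i+1}$ for $i<n$; $\bar n\mapsto n$ for $i=n$); $\ddot{f}_i(w)$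 is defined iff $\ddot{\varphi}_i(w)>0$ and is obtained by replacing the left-most letter of $w$ lying in $\{i,\overline{i+1}\}$ by its image ($i\mapsto i+1$, $\overline{i+1}\mapsto\bar i$ for $i<n$; $n\mapsto\bar n$ for $i=n$). The connected component $C_n^*(w)$ is the set of words obtained from $w$ by finitely many (defined) applications of the operators $\ddot{e}_i,\ddot{f}_i$. Hypoplactic congruence: $u\ddot{\sim}v$ iff there is a bijection $\psi:C_n^*(u)\to C_n^*(v)$ with $\psi(u)=v$ such that for all $x\in C_n^*(u)$ and $i$: $\psi(x)$ has the same $\mathrm{wt},\ddot{\varepsilon}_i,\ddot{\varphi}_i$ as $x$, $\ddot{e}_i(\psi(x))$ is defined iff $\ddot{e}_i(x)$ is (and then $\psi(\ddot{e}_i(x))=\ddot{e}_i(\psi(x))$), and likewise for $\ddot{f}_i$. *)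

(* Defs.v *)
From mathcomp Require Import all_boot all_algebra.
From mathcomp Require Import classical_sets functions.

Set Implicit Arguments.
Unset Strict Implicit.
Unset Printing Implicit Defensive.

(* Indices are 0-based: [i : 'I_n] stands for the index i + 1 of {1, ..., n},
   [inl i] for the letter i + 1 and [inr i] for the barred letter i + 1.
   The order of the alphabet plays no role in the quasi-crystal structure. *)
Notation letter n := ('I_n + 'I_n)%type.

Notation word n := (seq (letter n)).

Section QuasiCrystal.
Variable n : nat.
Implicit Types (i : 'I_n) (x : letter n) (u v w : word n).

(* x \in {i, bar (i+1)}; the second case is empty when i is the last index. *)
Definition phi_letter i x : bool :=
  match x with inl j => j == i | inr j => j == i.+1 :> nat end.

(* x \in {i+1, bar i} *)
Definition eps_letter i x : bool :=
  match x with inl j => j == i.+1 :> nat | inr j => j == i end.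

Fixpoint inversion i w : bool :=
  if w is x :: w' then phi_letter i x && has (eps_letter i) w' || inversion i w'
  else false.

Lemma inversionP i w :
  reflect (exists w1 x w2 y w3, [/\ w = w1 ++ x :: w2 ++ y :: w3,
             phi_letter i x & eps_letter i y])
          (inversion i w).
Proof.
elim: w => [|a w IHw] /=; first by constructor=> -[[|? ?] [? [? [? [? []]]]]].
apply: (iffP orP) => [[/andP[pa /hasP[y y_w ey]]|/IHw]|].
- case/splitPr: y_w => w2 w3; by exists [::], a, w2, y, w3.
- move=> [w1 [x [w2 [y [w3 [-> px ey]]]]]].
  by exists (a :: w1), x, w2, y, w3.
- move=> [[|b w1] [x [w2 [y [w3 [[-> w_def] px ey]]]]]].
    by left; rewrite px w_def has_cat /= ey orbT.
  by right; apply/IHw; exists w1, x, w2, y, w3.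
Qed.

Definition wt w : 'rV[int]_n :=
  \row_i ((count_mem (inl i : letter n) w)%:Z
          - (count_mem (inr i : letter n) w)%:Z)%R.

(* [None] is +oo. *)
Definition eps i w : option nat :=
  if inversion i w then None else Some (count (eps_letter i) w).

Definition phi i w : option nat :=
  if inversion i w then None else Some (count (phi_letter i) w).

(* Image of a letter of {i+1, bar i}: i+1 |-> i, and bar i |-> bar (i+1), or
   bar i |-> i for the last index.  Irrelevant on other letters. *)
Definition e_letter i x : letter n :=
  match x with
  | inl _ => inl i
  | inr _ => if (insub i.+1 : option 'I_n) is Some j then inr j else inl i
  end.

(* Image of a letter of {i, bar (i+1)}: bar (i+1) |-> bar i, and i |-> i+1, or
   i |-> bar i for the last index.  Irrelevant on other letters. *)
Definition f_letter i x : letter n :=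
  match x with
  | inl _ => if (insub i.+1 : option 'I_n) is Some j then inl j else inr i
  | inr _ => inr i
  end.

Fixpoint map_first (T : Type) (p : pred T) (g : T -> T) (s : seq T) : seq T :=
  if s is x :: s' then if p x then g x :: s' else x :: map_first p g s'
  else [::].

Definition map_last (T : Type) (p : pred T) (g : T -> T) (s : seq T) : seq T :=
  rev (map_first p g (rev s)).

(* [None] is "undefined". *)
Definition e_op i w : option (word n) :=
  if eps i w is Some k then
    if 0 < k then Some (map_last (eps_letter i) (e_letter i) w) else None
  else None.

Definition f_op i w : option (word n) :=
  if phi i w is Some k then
    if 0 < k then Some (map_first (phi_letter i) (f_letter i) w) else None
  else None.

Inductive component w : set (word n) :=
| component_refl : component w w
| component_e i u v : component w u -> e_op i u = Some v -> component w v
| component_f i u v : component w u -> f_op i u = Some v -> component w v.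

(* The [omap] equations say that one side is defined iff the other one is, and
   that the values then correspond under [psi]. *)
Definition hypoplactic u v : Prop :=
  exists psi : word n -> word n,
    [/\ set_bij (component u) (component v) psi,
        psi u = v &
        forall w, component u w ->
          wt (psi w) = wt w /\
          forall i,
            [/\ eps i (psi w) = eps i w,
                phi i (psi w) = phi i w,
                e_op i (psi w) = omap psi (e_op i w) &
                f_op i (psi w) = omap psi (f_op i w)]].

End QuasiCrystal.

Definition letter1 (n : nat) (n_ge2 : 2 <= n) : letter n :=
  inl (Ordinal (ltnW n_ge2)).

Definition letter1bar (n : nat) (n_ge2 : 2 <= n) : letter n :=
  inr (Ordinal (ltnW n_ge2)).

(* Main.v *)
(* Operators preserve hypoplactic congruence, are injective, and map a word
   flanked by 1 ... bar1 (that is, of the form a 1 bar1, 1 a bar1 or 1 bar1 a) to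
   a word of the same form, since index 1 is blocked by an inversion while the
   other indices only see the letter a.  This gives the congruence of these three
   words, and for the converse it allows to raise both words by e_i until no e_i
   is defined.  Such words of length 3 form a short list.  Weights and inversions
   separate all pairs in it except 112 / 121, 122 / 212 and bar1 1 2 / {2 1 bar1,
   1 2 bar1, 1 bar1 2}.  For these, the operators f_i with i >= 2 carry every
   occurrence of 2 to bar2 on both sides without touching 1 and bar1, and there
   the inversions, possibly after applying f_1, differ. *)
Require Import Defs.
From mathcomp Require Import all_boot all_order all_algebra.
From mathcomp Require Import classical_sets functions.
From mathcomp Require Import zify ring.

Set Implicit Arguments.
Unset Strict Implicit.
Unset Printing Implicit Defensive.

(** * Replacing the first or the last letter with a given property *)

Section Replacement.
Variables (T : Type) (p : pred T) (g : T -> T).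
Implicit Types (x : T) (s : seq T).

Lemma map_first_cat s1 x s2 :
  ~~ has p s1 -> p x -> map_first p g (s1 ++ x :: s2) = s1 ++ g x :: s2.
Proof.
by move=> + px; elim: s1 => [|y s1 IHs] /=; [rewrite px|case: (p y) => // /IHs->].
Qed.

Lemma map_last_cat s1 x s2 :
  p x -> ~~ has p s2 -> map_last p g (s1 ++ x :: s2) = s1 ++ g x :: s2.
Proof.
move=> px ps2; rewrite /map_last rev_cat rev_cons cat_rcons map_first_cat ?has_rev //.
by rewrite rev_cat rev_cons revK cat_rcons revK.
Qed.

Lemma has_split_first s : has p s ->
  exists s1 x s2, [/\ s = s1 ++ x :: s2, p x & ~~ has p s1].
Proof. by case/split_find => x s1 s2 px ps1; exists s1, x, s2; rewrite cat_rcons. Qed.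

Lemma has_split_last s : has p s ->
  exists s1 x s2, [/\ s = s1 ++ x :: s2, p x & ~~ has p s2].
Proof.
rewrite -has_rev => /has_split_first[s1 [x [s2 [es px ps1]]]].
exists (rev s2), x, (rev s1); rewrite has_rev; split=> //.
by rewrite -[s]revK es rev_cat rev_cons cat_rcons.
Qed.

End Replacement.

(** * The operators as rewritings of a single letter, and their effect on rank and weight *)

Section Operators.
Variable n : nat.
Implicit Types (i j : 'I_n) (x y : letter n) (u v w s : word n).

Lemma inversion_cat i s1 s2 :
  inversion i (s1 ++ s2) =
    [|| inversion i s1, inversion i s2 | has (phi_letter i) s1 && has (eps_letter i) s2].
Proof.
elim: s1 => [|x s1 IHs] /=; first by rewrite orbF.
rewrite has_cat {}IHs; case: (phi_letter i x) => //=.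
by case: (has _ s1) (has _ s2) (inversion i s1) (inversion i s2) (has _ s1) => [] [] [] [] [].
Qed.

Lemma inversion_phi i w : inversion i w -> has (phi_letter i) w.
Proof. by elim: w => //= x w IHw /orP[/andP[->]//|/IHw->]; rewrite orbT. Qed.

Lemma inversion_eps i w : inversion i w -> has (eps_letter i) w.
Proof. by elim: w => //= x w IHw /orP[/andP[_ ->]|/IHw->]; rewrite orbT. Qed.

Lemma phi_eps_letter i x : phi_letter i x -> ~~ eps_letter i x.
Proof. case: x => j /= /eqP; [move->|move=> ej; apply/eqP => ji; move: ej; rewrite ji]; lia. Qed.

Lemma phi_e_letter i x : eps_letter i x -> phi_letter i (e_letter i x).
Proof. by case: x => j /=; [|case: insubP => //= k _ ->]. Qed.

Lemma e_letterK i x : eps_letter i x -> f_letter i (e_letter i x) = x.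
Proof.
case: x => j /= /eqP ej.
  by case: insubP => [k _ ek|]; [congr inl; apply: val_inj; rewrite /= ek|rewrite -ej ltn_ord].
rewrite ej; case E: (insub _) => [k|] //=; by rewrite E.
Qed.

(** An inversion would have to start at [x] or later, hence end inside [s2], which has no letter to
    end it. This is the exact situation in which an operator of index [i] acts at [x]. *)
Lemma inversion_flanked i s1 x s2 :
  ~~ has (phi_letter i) s1 -> ~~ has (eps_letter i) s2 ->
  inversion i (s1 ++ x :: s2) = false.
Proof.
move=> p1 e2; rewrite inversion_cat (negPf p1) /= (negPf e2) andbF orbF.
by rewrite (contraNF (@inversion_phi i s1) p1) (contraNF (@inversion_eps i s2) e2).
Qed.

Lemma e_op_cat i s1 x s2 :
  ~~ has (phi_letter i) s1 -> eps_letter i x -> ~~ has (eps_letter i) s2 ->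
  e_op i (s1 ++ x :: s2) = Some (s1 ++ e_letter i x :: s2).
Proof.
move=> p1 ex e2; rewrite /e_op /eps inversion_flanked // -has_count has_cat /= ex orbT.
by rewrite map_last_cat.
Qed.

Lemma f_op_cat i s1 x s2 :
  ~~ has (phi_letter i) s1 -> phi_letter i x -> ~~ has (eps_letter i) s2 ->
  f_op i (s1 ++ x :: s2) = Some (s1 ++ f_letter i x :: s2).
Proof.
move=> p1 px e2; rewrite /f_op /phi inversion_flanked // -has_count has_cat /= px orbT.
by rewrite map_first_cat.
Qed.

Lemma e_op_split i u v : e_op i u = Some v ->
  exists s1 x s2, [/\ u = s1 ++ x :: s2, v = s1 ++ e_letter i x :: s2,
    eps_letter i x, ~~ has (phi_letter i) s1 & ~~ has (eps_letter i) s2].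
Proof.
move=> eu; move: (eu); rewrite /e_op /eps.
case: ifPn => // inv; rewrite -has_count; case: ifP => // /has_split_last.
move=> [s1 [x [s2 [def_u ex e2]]]] _.
(* A letter of {i, bar (i+1)} to the left of [x] would form an inversion with [x]. *)
have p1: ~~ has (phi_letter i) s1.
  by apply: contra inv => p1; rewrite def_u inversion_cat p1 /= ex !orbT.
exists s1, x, s2; split=> //.
by move: eu; rewrite def_u e_op_cat // => -[].
Qed.

(** The conditions on [s1] and [s2] in [e_op_split] do not involve the letter between them, so after
    the replacement they single out the same position for f_i. *)
Lemma e_opK i u v : e_op i u = Some v -> f_op i v = Some u.
Proof.
case/e_op_split=> [s1 [x [s2 [-> -> ex p1 e2]]]].
by rewrite f_op_cat ?phi_e_letter // e_letterK.
Qed.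

Lemma size_e_op i u v : e_op i u = Some v -> size v = size u.
Proof. by case/e_op_split=> [s1 [x [s2 [-> -> _ _ _]]]]; rewrite !size_cat. Qed.

Lemma e_op_no_eps i w : ~~ has (eps_letter i) w -> e_op i w = None.
Proof. by rewrite has_count /e_op /eps => /negPf; case: ifP => // _ ->. Qed.

Lemma f_op_no_phi i w : ~~ has (phi_letter i) w -> f_op i w = None.
Proof. by rewrite has_count /f_op /phi => /negPf; case: ifP => // _ ->. Qed.

Lemma e_op_inversion i w : inversion i w -> e_op i w = None.
Proof. by rewrite /e_op /eps => ->. Qed.

Lemma f_op_inversion i w : inversion i w -> f_op i w = None.
Proof. by rewrite /f_op /phi => ->. Qed.

Lemma e_op_None i w : e_op i w = None -> has (eps_letter i) w -> inversion i w.
Proof. by rewrite has_count /e_op /eps; case: ifP => // _; case: ifP. Qed.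

(* The position of a letter in the order 1 < ... < n < bar n < ... < bar 1. *)
Definition rank x : nat := match x with inl j => j | inr j => n.*2 - j end.

Lemma rank_e_letter i x : eps_letter i x -> rank (e_letter i x) < rank x.
Proof.
case: x => j /= /eqP ej; first by rewrite ej.
rewrite ej; have := ltn_ord i; case: insubP => [k /= ltk ek|] lti; rewrite /= ?ek; lia.
Qed.

(** This is the measure for the induction that raises a word until no e_i is defined. *)
Lemma rank_e_op i u v : e_op i u = Some v -> sumn (map rank v) < sumn (map rank u).
Proof.
case/e_op_split=> [s1 [x [s2 [-> -> ex _ _]]]].
by rewrite !map_cat !sumn_cat /= ltn_add2l ltn_add2r rank_e_letter.
Qed.

Import GRing.Theory.
Local Open Scope ring_scope.

(** A sum over the letters of a function that changes sign under barring depends on the weight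
    alone. It yields two numerical invariants: the sum of the codes and the sum of the signs. *)
Lemma sum_wt (h : 'I_n -> int) w :
  \sum_i wt w ord0 i * h i =
  \sum_(x <- w) match x with inl j => h j | inr j => - h j end.
Proof.
elim: w => [|x w IHw]; first by rewrite big_nil big1 // => i _; rewrite mxE mul0r.
rewrite big_cons -IHw.
have delta j : h j = \sum_i (j == i)%:R * h i.
  rewrite (bigD1 j) //= eqxx mul1r big1 ?addr0 // => i.
  by rewrite eq_sym => /negPf->; rewrite mul0r.
case: x => j; rewrite delta -?sumrN -big_split /=;
  apply: eq_bigr => i _; rewrite !mxE /= !PoszD.
  rewrite -[inl j == inl i]/(j == i).
  by case: (j == i); ring.
rewrite -[inr j == inr i]/(j == i).
by case: (j == i); ring.
Qed.

End Operators.

(** * Bisimilarity, a consequence of the congruence that can be followed one operator at a time *)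

Section Bisimilarity.
Variable n : nat.
Implicit Types (i j : 'I_n) (x y : letter n) (u v w s : word n).

Definition opt_rel (T : Type) (R : T -> T -> Prop) (o1 o2 : option T) : Prop :=
  match o1, o2 with
  | Some a, Some b => R a b
  | None, None => True
  | _, _ => False
  end.

(** Separating two words needs only necessary conditions that survive each operator. A relation
    passes to the images directly, whereas a bijection of components would have to be
    transported. *)
Definition bisimulation (R : word n -> word n -> Prop) : Prop :=
  forall u v, R u v ->
    wt u = wt v /\
    forall i, [/\ inversion i u = inversion i v,
      opt_rel R (e_op i u) (e_op i v) & opt_rel R (f_op i u) (f_op i v)].

Definition bisimilar u v : Prop := exists2 R, bisimulation R & R u v.

Lemma hypoplactic_bisimilar u v : hypoplactic u v -> bisimilar u v.
Proof.
move=> [psi [_ psi_u psiP]].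
(* The relation is the graph of [psi] on the component of [u]. *)
exists (fun w w' => component u w /\ w' = psi w); last by split=> //; exact: component_refl.
move=> x _ [ux ->]; have [-> opP] := psiP x ux; split=> // i.
have [ei _ -> ->] := opP i; split.
- by move: ei; rewrite /eps; do 2!case: ifP.
- by case E: (e_op i x) => //=; split=> //; exact: component_e ux E.
- by case E: (f_op i x) => //=; split=> //; exact: component_f ux E.
Qed.

Lemma bisimilar_sym u v : bisimilar u v -> bisimilar v u.
Proof.
move=> [R simR Ruv]; exists (fun w w' => R w' w) => // x y /simR[-> opP].
split=> // i; have [-> eR fR] := opP i; split=> //.
  by move: eR; case: e_op; case: e_op.
by move: fR; case: f_op; case: f_op.
Qed.

Lemma bisimilar_wt u v : bisimilar u v -> wt u = wt v.
Proof. by case=> R simR /simR[]. Qed.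

Lemma bisimilar_inversion i u v : bisimilar u v -> inversion i u = inversion i v.
Proof. by case=> R simR /simR[_ /(_ i)[]]. Qed.

Lemma bisimilar_e i u v : bisimilar u v -> opt_rel bisimilar (e_op i u) (e_op i v).
Proof.
case=> R simR /simR[_ /(_ i)[_ + _]].
by case: e_op => [?|]; case: e_op => [?|] //= ?; exists R.
Qed.

Lemma bisimilar_f i u v : bisimilar u v -> opt_rel bisimilar (f_op i u) (f_op i v).
Proof.
case=> R simR /simR[_ /(_ i)[_ _]].
by case: f_op => [?|]; case: f_op => [?|] //= ?; exists R.
Qed.

Lemma bisimilar_fSome i u v u' v' :
  f_op i u = Some u' -> f_op i v = Some v' -> bisimilar u v -> bisimilar u' v'.
Proof. by move=> eu ev /(bisimilar_f i); rewrite eu ev. Qed.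

End Bisimilarity.

(** * Words of length 3 on which no e_i is defined, as integer triples *)

Section Codes.
Import GRing.Theory Num.Theory Order.TTheory.
Local Open Scope ring_scope.
Implicit Types k p q r : int.

(* A letter a in {1, ..., n} is encoded by the integer a and bar a by -a; in
   this section k ranges over the indices, which are 1-based. *)
Definition phi_code k p : Prop := p = k \/ p = - (k + 1).
Definition eps_code k p : Prop := p = k + 1 \/ p = - k.
Definition inv_code k p q r : Prop :=
  phi_code k p /\ (eps_code k q \/ eps_code k r) \/ phi_code k q /\ eps_code k r.

Definition code_word (n : nat) p q r : Prop :=
  [/\ 1 <= `|p| <= n%:Z, 1 <= `|q| <= n%:Z & 1 <= `|r| <= n%:Z].

(* Every e_k is undefined, since w has a k-inversion as soon as eps_k(w) > 0. *)
Definition highest_code (n : nat) p q r : Prop :=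
  forall k, 1 <= k <= n%:Z ->
    eps_code k p \/ eps_code k q \/ eps_code k r -> inv_code k p q r.

Definition one_before_onebar p q r : Prop :=
  p = 1 /\ (q = - 1 \/ r = - 1) \/ q = 1 /\ r = - 1.

(** The clauses are: a letter 1, 2 or bar1 inserted into 1 bar1 (the sum is the code of that
    letter); 111, 112, 121, 122, 123 and 1 2 bar2; 212, bar1 1 2 and bar1 1 bar1; finally, for a >
    1, the families bar a a (a+1), bar a a bar a, a bar a a and a bar a bar(a-1). *)
Definition highest_shape p q r : Prop :=
  one_before_onebar p q r /\ (p + q + r = 1 \/ p + q + r = 2 \/ p + q + r = - 1) \/
  p = 1 /\ (q = 1 /\ (r = 1 \/ r = 2) \/ q = 2 /\ (r = 1 \/ r = 2) \/
            q = 2 /\ (r = 3 \/ r = - 2)) \/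
  q = 1 /\ (p = 2 /\ r = 2 \/ p = - 1 /\ r = 2 \/ p = - 1 /\ r = - 1) \/
  q = - p /\ (p < - 1 /\ (r = 1 - p \/ r = p) \/ 1 < p /\ (r = p \/ r = 1 - p)).

(** Every letter other than 1 lies in {k+1, bar k} for some index k, so the word must have a
    k-inversion. This ties each such letter to its neighbours and leaves finitely many patterns. *)
Lemma highest_codeP n p q r : 
  code_word n p q r -> highest_code n p q r -> highest_shape p q r.
Proof.
move=> [np nq nr] hw.
have lower x : 1 <= `|x| <= n%:Z -> (x = p \/ x = q \/ x = r) ->
    x = 1 \/ exists k, [/\ 1 <= k, eps_code k x & inv_code k p q r].
  move=> nx ex; have [x1|x1] := eqVneq x 1; [by left|right].
  have [k [nk ek]] : exists k, 1 <= k <= n%:Z /\ eps_code k x.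
    exists (if 0 < x then x - 1 else - x); rewrite /eps_code; case: ifP; lia.
  exists k; split=> //; [by case/andP: nk|apply: hw => //].
  by case: ex => [<-|[<-|<-]]; auto.
rewrite /highest_shape /one_before_onebar.
move: (lower p np) (lower q nq) (lower r nr); rewrite /eps_code /inv_code /phi_code /eps_code.
move=> /(_ (or_introl erefl)) lp /(_ (or_intror (or_introl erefl))) lq.
move=> /(_ (or_intror (or_intror erefl))) lr.
clear lower hw np nq nr.
move: lq lr; case: lp => [lp|[k [k1 ek ik]]] lq lr; last first.
  (* If [p] is not 1, it cannot start the k-inversion that it requires, so this inversion is formed
     by [q] and [r]. *)
  have [{}ik ir] : (q = k \/ q = - (k + 1)) /\ (r = k + 1 \/ r = - k).
    by clear lq lr; lia.
  (* If [q] is not 1, the inversion that it requires can only start at [p]. *)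
  have pq : q = 1 \/ q = - p.
    case: lq => [|[l [l1 el il]]]; [by left|right; clear lr].
    have {il} : p = l \/ p = - (l + 1) by lia.
    lia.
  clear lq lr; case: ek ik ir pq => -> [] -> [] -> []; lia.
(* From here on [p] is 1, so an inversion starting at [p] has index 1. *)
have {}lq : q = 1 \/ q = 2 \/ q = - 1.
  case: lq => [|[l [l1 el il]]]; [by left|right; clear lr].
  have {il} : p = l by lia.
  lia.
have {}lr : r = 1 \/ r = 2 \/ r = - 1 \/ q = 2 /\ (r = 3 \/ r = - 2).
  case: lr => [|[m [m1 em im]]]; [by left|right].
  have {im} : p = m \/ q = m \/ q = - (m + 1) by lia.
  lia.
subst p; case: lq lr => [->|[->|->]]; lia.
Qed.

Definition sign_code p : int := if 0 < p then 1 else - 1.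

Definition exceptional_pair p q r p' q' r' : Prop :=
  (p = 1 /\ q = 1 /\ r = 2) /\ (p' = 1 /\ q' = 2 /\ r' = 1) \/
  (p = 1 /\ q = 2 /\ r = 2) /\ (p' = 2 /\ q' = 1 /\ r' = 2) \/
  (p = - 1 /\ q = 1 /\ r = 2) /\ one_before_onebar p' q' r'.

Ltac split_cases H := match type of H with
  | _ \/ _ => let H1 := fresh in case: H => H1; split_cases H1
  | _ /\ _ => let H1 := fresh in let H2 := fresh in
      case: H => H1 H2; split_cases H1; split_cases H2
  | _ => idtac
  end.

Lemma highest_code_pair n p q r p' q' r' :
  (2 <= n)%N -> code_word n p q r -> code_word n p' q' r' ->
  highest_code n p q r -> highest_code n p' q' r' ->
  p + q + r = p' + q' + r' ->
  sign_code p + sign_code q + sign_code r =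
    sign_code p' + sign_code q' + sign_code r' ->
  (forall k, 1 <= k <= n%:Z -> inv_code k p q r <-> inv_code k p' q' r') ->
  (p = p' /\ q = q' /\ r = r') \/
  (one_before_onebar p q r /\ one_before_onebar p' q' r') \/
  exceptional_pair p q r p' q' r' \/ exceptional_pair p' q' r' p q r.
Proof.
move=> n2 wu wv hu hv eC eS eI.
have {hu} hu := highest_codeP wu hu; have {hv} hv := highest_codeP wv hv.
case: wu wv => np nq nr [np' nq' nr'].
(* With this dichotomy the signs can be generalized to plain integers, and every case becomes linear
   arithmetic. *)
have sP x : 0 < x /\ sign_code x = 1 \/ x <= 0 /\ sign_code x = - 1.
  by rewrite /sign_code; case: ifP; lia.
move: eS (sP p) (sP q) (sP r) (sP p') (sP q') (sP r').
move: (sign_code p) (sign_code q) (sign_code r).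
move: (sign_code p') (sign_code q') (sign_code r').
move=> sp' sq' sr' sp sq sr eS {sP} Hp Hq Hr Hp' Hq' Hr'.
rewrite /exceptional_pair; rewrite /highest_shape /one_before_onebar in hu hv *.
split_cases hu; split_cases hv.
all: try (exfalso; clear eI np nq nr np' nq' nr'; lia).
(* The surviving pairs differ in the inversions of index 2 (for words such as
   1 2 bar2), or of index |r| or |r| + 1. *)
all: have I2 := eI 2; have Ir := eI r; have Ir' := eI (1 - r); clear eI.
all: repeat match goal with H : ?x = _ |- _ => subst x end.
all: try solve [right; left; clear; lia | left; clear I2 Ir Ir'; lia].
all: rewrite /inv_code /phi_code /eps_code in I2 Ir Ir'.
all: try (exfalso; clear Ir Ir'; lia).
all: try (exfalso; clear I2 Ir'; lia).
all: try (exfalso; clear I2 Ir; lia).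
(* Only the exceptional pairs are left. *)
all: right; right; clear.
all: lia.
Qed.
End Codes.

(** * Separating the exceptional pairs by carrying 2 to bar2 *)

Section Separation.
Variables (n : nat) (n_ge2 : 2 <= n).
Implicit Types (i j k : 'I_n) (a c : letter n) (u v w s t : word n).

Let i1 : 'I_n := Ordinal (ltnW n_ge2).
Let i2 : 'I_n := Ordinal n_ge2.
Let one : letter n := letter1 n_ge2.
Let onebar : letter n := letter1bar n_ge2.
Let two : letter n := inl i2.
Let twobar : letter n := inr i2.

(** The letters 1 and bar1 are invisible to all operators of index at least 2, that is, of 0-based
    index [i > 0]. *)
Definition outer c : bool := match c with inl j | inr j => j == 0 :> nat end.

Lemma outer_phi i s : 0 < i -> all outer s -> ~~ has (phi_letter i) s.
Proof.
move=> i_gt0; rewrite -all_predC; apply: sub_all => -[] j /= /eqP j0.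
  by apply: contraTneq i_gt0 => <-; rewrite j0.
by rewrite j0.
Qed.

Lemma outer_eps i s : 0 < i -> all outer s -> ~~ has (eps_letter i) s.
Proof.
move=> i_gt0; rewrite -all_predC; apply: sub_all => -[] j /= /eqP j0.
  by rewrite j0.
by apply: contraTneq i_gt0 => <-; rewrite j0.
Qed.

Lemma f_letter_inl i j k : k = i.+1 :> nat -> f_letter i (inl j) = inl k.
Proof. by move=> ek; rewrite /= -ek valK. Qed.

Lemma f_letter_last i j : i.+1 = n -> f_letter i (inl j) = inr i.
Proof. by move=> ei; rewrite /= insubN // ei ltnn. Qed.

(* The operators f_2, ..., f_n, f_(n-1), ..., f_2 carry 2 through 3, ..., n,
   bar n, ... to bar2. *)
Lemma f_letter_inner (P : letter n -> Prop) :
  (forall i c, 0 < i -> phi_letter i c -> P c -> P (f_letter i c)) ->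
  P two -> P twobar.
Proof.
move=> stepP P2.
have Pinl m j : j = m.+1 :> nat -> P (inl j).
  elim: m j => [|m IHm] j ej; first by rewrite (_ : j = i2) //; apply: val_inj.
  have lt_m : m.+1 < n by rewrite (leq_trans _ (ltn_ord j)) ?ej.
  rewrite -(f_letter_inl (i := Ordinal lt_m) (Ordinal lt_m) ej).
  by apply: stepP => //=; apply: IHm.
(* Here [d] is the distance from [j] to the last index. At distance 0 the letter n turns into bar n;
   for n = 2 this is already the step from 2 to bar2. *)
have Pinr d j : 0 < j -> j + d.+1 = n -> P (inr j).
  elim: d j => [|d IHd] j j_gt0 ej.
    have ej1 : j.+1 = n by rewrite -addn1.
    rewrite -(f_letter_last j ej1); apply: stepP => //=.
    by apply: (Pinl j.-1); rewrite prednK.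
  have lt_j : j.+1 < n by lia.
  rewrite -[inr j]/(f_letter j (inr (Ordinal lt_j))).
  by apply: stepP => //=; apply: IHd => //=; lia.
by apply: (Pinr (n - 2)) => //=; lia.
Qed.

Lemma f_op_one_hole i c s1 s2 :
  0 < i -> phi_letter i c -> all outer s1 -> all outer s2 ->
  f_op i (s1 ++ c :: s2) = Some (s1 ++ f_letter i c :: s2).
Proof. by move=> i_gt0 pc o1 o2; rewrite f_op_cat ?outer_phi ?outer_eps. Qed.

(** After the carry, two applications of f_1 lead from 1 1 bar2 to 2 2 bar2, but from 1 bar2 1 to 2
    bar1 1, as bar2 now precedes the remaining 1. Only the first result has a 2-inversion. *)
Lemma separate_112_121 : ~ bisimilar [:: one; one; two] [:: one; two; one].
Proof.
pose P c := bisimilar [:: one; one; c] [:: one; c; one].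
move=> P2; have {P2} : P twobar.
  apply: f_letter_inner P2 => i c i_gt0 pc; apply: bisimilar_fSome.
    exact: (f_op_one_hole (s1 := [:: one; one]) (s2 := [::])).
  exact: (f_op_one_hole (s1 := [:: one]) (s2 := [:: one])).
have f12 : f_letter i1 one = two by apply: f_letter_inl.
have f1 s : ~~ has (eps_letter i1) s -> f_op i1 (one :: s) = Some (two :: s).
  by move=> e1; rewrite (f_op_cat (s1 := [::])) // f12.
move/(bisimilar_fSome (f1 [:: one; twobar] isT) (f1 [:: twobar; one] isT)).
have f2 : f_op i1 [:: two; one; twobar] = Some [:: two; two; twobar].
  by rewrite (f_op_cat (s1 := [:: two]) (s2 := [:: twobar])) // f12.
have f3 : f_op i1 [:: two; twobar; one] = Some [:: two; onebar; one].
  by rewrite (f_op_cat (s1 := [:: two]) (s2 := [:: one])).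
by move/(bisimilar_fSome f2 f3)/(bisimilar_inversion i2).
Qed.

(** The carried letter occurs twice, so each step of the carry applies f_i twice. At the end f_1
    gives 2 bar2 bar2 and bar1 1 bar2, and only the former has a 2-inversion. *)
Lemma separate_122_212 : ~ bisimilar [:: one; two; two] [:: two; one; two].
Proof.
pose P c := bisimilar [:: one; c; c] [:: c; one; c].
move=> P2; have {P2} : P twobar.
  apply: f_letter_inner P2 => i c i_gt0 pc Pc.
  have p1 := outer_phi (s := [:: one]) i_gt0 isT.
  have ec := phi_eps_letter pc.
  (* This makes the second application of f_i act on the other copy of [c]. *)
  have pc' : ~~ phi_letter i (f_letter i c).
    case: (c) => j //=; last by rewrite ltn_eqF.
    case: insubP => [k _ /= ek|_] /=; last by rewrite ltn_eqF.
    by apply/eqP => ki; move: ek; rewrite ki => /n_Sn.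
  have f1 : f_op i [:: one; c; c] = Some [:: one; f_letter i c; c].
    by rewrite (f_op_cat (s1 := [:: one]) (s2 := [:: c])) //= orbF.
  have f2 : f_op i [:: c; one; c] = Some [:: f_letter i c; one; c].
    rewrite (f_op_cat (s1 := [::]) (s2 := [:: one; c])) //=.
    by rewrite orbF.
  have f3 : f_op i [:: one; f_letter i c; c] = Some [:: one; f_letter i c; f_letter i c].
    rewrite (f_op_cat (s1 := [:: one; f_letter i c]) (s2 := [::])) //=.
    by move: p1 pc'; rewrite /= !orbF negb_or => -> /negPf->.
  have f4 : f_op i [:: f_letter i c; one; c] = Some [:: f_letter i c; one; f_letter i c].
    rewrite (f_op_cat (s1 := [:: f_letter i c; one]) (s2 := [::])) //=.
    by move: p1 pc'; rewrite /= !orbF negb_or => -> /negPf->.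
  exact: bisimilar_fSome f3 f4 (bisimilar_fSome f1 f2 Pc).
have f12 : f_letter i1 one = two by apply: f_letter_inl.
have f1 : f_op i1 [:: one; twobar; twobar] = Some [:: two; twobar; twobar].
  by rewrite (f_op_cat (s1 := [::])) // f12.
have f2 : f_op i1 [:: twobar; one; twobar] = Some [:: onebar; one; twobar].
  by rewrite (f_op_cat (s1 := [::])).
by move/(bisimilar_fSome f1 f2)/(bisimilar_inversion i2).
Qed.

(** The pair 1 2 is a 1-inversion but 1 bar2 is not. Once 2 has become bar2, the left word has no
    1-inversion, while 1 before bar1 still gives one on the right. *)
Lemma separate_flank s1 s2 : s1 ++ s2 = [:: one; onebar] ->
  ~ bisimilar [:: onebar; one; two] (s1 ++ two :: s2).
Proof.
move=> s12 P2.
have : bisimilar [:: onebar; one; twobar] (s1 ++ twobar :: s2).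
  move: P2; apply: (@f_letter_inner (fun c => bisimilar [:: onebar; one; c] (s1 ++ c :: s2))).
  have /andP[o1 o2]: all outer s1 && all outer s2 by rewrite -all_cat s12.
  move=> i c i_gt0 pc; apply: bisimilar_fSome; last exact: f_op_one_hole.
  exact: (f_op_one_hole (s1 := [:: onebar; one]) (s2 := [::])).
move/(bisimilar_inversion i1); case: s1 s12 {P2} => [|x [|y [|]]] //=.
- by move=> ->.
- by case=> -> ->.
- by case=> -> -> ->.
Qed.

(** * Words with a letter inserted into 1 bar1 *)

Lemma inversion_flank i a s1 s2 : s1 ++ s2 = [:: one; onebar] ->
  inversion i (s1 ++ a :: s2) = (i == 0 :> nat).
Proof.
have [i0|i_gt0] := posnP i; last first.
  move=> s12; have /andP[o1 o2]: all outer s1 && all outer s2 by rewrite -all_cat s12.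
  by rewrite inversion_flanked ?outer_phi ?outer_eps.
have -> : i = i1 by apply: val_inj.
by case: s1 => [|x [|y [|]]] //= => [->|[-> ->]|[-> -> ->]]; rewrite /= ?orbT.
Qed.

Lemma f_op_flank i a s1 s2 : s1 ++ s2 = [:: one; onebar] ->
  f_op i (s1 ++ a :: s2) =
    if (0 < i) && phi_letter i a then Some (s1 ++ f_letter i a :: s2) else None.
Proof.
move=> s12; have /andP[o1 o2]: all outer s1 && all outer s2 by rewrite -all_cat s12.
have [i0|i_gt0] := posnP i; first by rewrite f_op_inversion // inversion_flank // i0.
case: ifP => /= pa; first by rewrite f_op_one_hole.
rewrite f_op_no_phi // has_cat /= pa !negb_or.
by rewrite !outer_phi.
Qed.

Lemma e_op_flank i a s1 s2 : s1 ++ s2 = [:: one; onebar] ->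
  e_op i (s1 ++ a :: s2) =
    if (0 < i) && eps_letter i a then Some (s1 ++ e_letter i a :: s2) else None.
Proof.
move=> s12; have /andP[o1 o2]: all outer s1 && all outer s2 by rewrite -all_cat s12.
have [i0|i_gt0] := posnP i; first by rewrite e_op_inversion // inversion_flank // i0.
case: ifP => /= ea; first by rewrite e_op_cat ?outer_phi ?outer_eps.
rewrite e_op_no_eps // has_cat /= ea !negb_or.
by rewrite !outer_eps.
Qed.

(** Whether an operator is defined, and what it does to the inserted letter, does not depend on the
    place of insertion, so a path of operators can be replayed at any other place. *)
Lemma component_flank a s1 s2 t1 t2 w :
  s1 ++ s2 = [:: one; onebar] -> t1 ++ t2 = [:: one; onebar] ->
  component (s1 ++ a :: s2) w ->
  exists2 b, w = s1 ++ b :: s2 & component (t1 ++ a :: t2) (t1 ++ b :: t2).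
Proof.
move=> s12 t12; elim=> [|i u v _ [b -> tb]|i u v _ [b -> tb]].
- by exists a => //; apply: component_refl.
- rewrite e_op_flank //; case: ifP => // ib [<-]; exists (e_letter i b) => //.
  by apply: (component_e (i := i) tb); rewrite e_op_flank ?ib.
- rewrite f_op_flank //; case: ifP => // ib [<-]; exists (f_letter i b) => //.
  by apply: (component_f (i := i) tb); rewrite f_op_flank ?ib.
Qed.

Lemma hypoplactic_flank a s1 s2 t1 t2 :
  s1 ++ s2 = [:: one; onebar] -> t1 ++ t2 = [:: one; onebar] ->
  hypoplactic (s1 ++ a :: s2) (t1 ++ a :: t2).
Proof.
(* The map moves the inserted letter to its new place. On the component the position [size s1]
   always exists, so the default [a] is never returned for lack of a letter. *)
move=> s12 t12; pose psi w := t1 ++ nth a w (size s1) :: t2.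
have psiE b : psi (s1 ++ b :: s2) = t1 ++ b :: t2.
  by rewrite /psi nth_cat ltnn subnn.
(* Equal letter counts give equal weights and equal values of eps_i and phi_i. *)
have perm b : perm_eq (t1 ++ b :: t2) (s1 ++ b :: s2).
  by rewrite -[b :: t2]cat1s -[b :: s2]cat1s perm_catCA t12 perm_sym perm_catCA s12.
exists psi; split=> //.
  split.
  - by move=> w /(component_flank s12 t12)[b -> tb]; rewrite psiE.
  - move=> w w'; rewrite !inE => /(component_flank s12 t12)[b -> _].
    move=> /(component_flank s12 t12)[c -> _]; rewrite !psiE.
    by move/(congr1 (fun w => nth a w (size t1))); rewrite !nth_cat ltnn subnn /= => ->.
  - move=> w /(component_flank t12 s12)[b -> sb].
    by exists (s1 ++ b :: s2).
move=> w /(component_flank s12 t12)[b -> _]; rewrite psiE; split.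
  by apply/rowP => i; rewrite !mxE !(permP (perm b)).
move=> i; rewrite /eps /phi !inversion_flank // !(permP (perm b)).
rewrite !e_op_flank // !f_op_flank //.
by split=> //; case: ifP => //= _; rewrite psiE.
Qed.

(** * Translation between words and integer codes *)

Import GRing.Theory.
Local Open Scope ring_scope.

Definition code c : int :=
  match c with inl j => (j.+1)%:Z | inr j => - (j.+1)%:Z end.

Lemma code_bound c : 1 <= `|code c| <= n%:Z.
Proof. by case: c => j /=; have := ltn_ord j; lia. Qed.

Lemma code_inj : injective code.
Proof.
by move=> [] j [] k /= ejk; do ?[congr inl|congr inr|apply: val_inj => /=]; lia.
Qed.

Lemma phi_codeP i c : reflect (phi_code (i.+1)%:Z (code c)) (phi_letter i c).
Proof.
rewrite /phi_code; apply: (iffP idP); case: c => j /=.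
- by move/eqP->; left.
- by move/eqP->; right; lia.
- by move=> ej; apply/eqP/val_inj => /=; lia.
- by move=> ej; apply/eqP; lia.
Qed.

Lemma eps_codeP i c : reflect (eps_code (i.+1)%:Z (code c)) (eps_letter i c).
Proof.
rewrite /eps_code; apply: (iffP idP); case: c => j /=.
- by move/eqP->; left; lia.
- by move/eqP->; right; lia.
- by move=> ej; apply/eqP; lia.
- by move=> ej; apply/eqP/val_inj => /=; lia.
Qed.

Lemma inv_codeP i x y z :
  reflect (inv_code (i.+1)%:Z (code x) (code y) (code z)) (inversion i [:: x; y; z]).
Proof.
rewrite /= !orbF !andbF !orbF /inv_code.
apply: (iffP orP).
  case=> /andP[/phi_codeP px]; last by move=> /eps_codeP; right.
  by case/orP=> /eps_codeP; left; split=> //; [left|right].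
case=> [[/phi_codeP px eyz]|[/phi_codeP py /eps_codeP ez]].
  by left; rewrite px; case: eyz => /eps_codeP ->; rewrite ?orbT.
by right; rewrite py.
Qed.

Lemma index_of_int (k : int) : 1 <= k <= n%:Z -> exists i : 'I_n, k = (i.+1)%:Z.
Proof.
move=> hk; have lt_k : (`|k|.-1 < n)%N by lia.
by exists (Ordinal lt_k) => /=; lia.
Qed.

Lemma bisimilar_sum_code u v : bisimilar u v ->
  \sum_(c <- u) code c = \sum_(c <- v) code c.
Proof.
move/bisimilar_wt => euv.
by rewrite -!(sum_wt (fun j : 'I_n => (j.+1)%:Z)) euv.
Qed.

Lemma bisimilar_sum_sign u v : bisimilar u v ->
  \sum_(c <- u) sign_code (code c) = \sum_(c <- v) sign_code (code c).
Proof.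
have signE w : \sum_(c <- w) sign_code (code c) =
    \sum_(c <- w) match c with inl _ => 1 | inr _ => - 1 end.
  by apply: eq_bigr => -[] j _; rewrite /sign_code.
move/bisimilar_wt => euv.
by rewrite !signE -!(sum_wt (fun=> 1)) euv.
Qed.

(** The codes of 1 and bar1 cancel, so the weight determines the inserted letter. *)
Lemma sum_code_flank a s1 s2 : s1 ++ s2 = [:: one; onebar] ->
  \sum_(c <- s1 ++ a :: s2) code c = code a.
Proof.
move=> s12; rewrite big_cat big_cons /= addrCA -big_cat s12.
by rewrite !big_cons big_nil [X in _ + X](_ : _ = 0) ?addr0.
Qed.

Lemma bisimilar_flank_eq a b s1 s2 t1 t2 :
  s1 ++ s2 = [:: one; onebar] -> t1 ++ t2 = [:: one; onebar] ->
  bisimilar (s1 ++ a :: s2) (t1 ++ b :: t2) -> a = b.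
Proof.
by move=> s12 t12 /bisimilar_sum_code; rewrite !sum_code_flank // => /code_inj.
Qed.

Lemma one_before_onebarP x y z :
  one_before_onebar (code x) (code y) (code z) ->
  exists a s1 s2, s1 ++ s2 = [:: one; onebar] /\ [:: x; y; z] = s1 ++ a :: s2.
Proof.
have e1 c : code c = 1 -> c = one by move=> ec; apply: code_inj.
have e1b c : code c = - 1 -> c = onebar by move=> ec; apply: code_inj.
case=> [[/e1-> [/e1b->|/e1b->]]|[/e1-> /e1b->]].
- by exists z, [:: one; onebar], [::].
- by exists y, [:: one], [:: onebar].
- by exists x, [::], [:: one; onebar].
Qed.

(** Splitting 1 bar1 into two arbitrary pieces treats the three places of insertion uniformly. *)
Definition same_flank u v : Prop :=
  exists a s1 s2 t1 t2, [/\ s1 ++ s2 = [:: one; onebar],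
    t1 ++ t2 = [:: one; onebar], u = s1 ++ a :: s2 & v = t1 ++ a :: t2].

Lemma exceptional_pair_separate x y z x' y' z' :
  exceptional_pair (code x) (code y) (code z) (code x') (code y') (code z') ->
  ~ bisimilar [:: x; y; z] [:: x'; y'; z'].
Proof.
have e1 c : code c = 1 -> c = one by move=> ec; apply: code_inj.
have e1b c : code c = - 1 -> c = onebar by move=> ec; apply: code_inj.
have e2 c : code c = 2 -> c = two by move=> ec; apply: code_inj.
case=> [[[/e1-> [/e1-> /e2->]] [/e1-> [/e2-> /e1->]]]|].
  exact: separate_112_121.
case=> [[[/e1-> [/e2-> /e2->]] [/e2-> [/e1-> /e2->]]]|].
  exact: separate_122_212.
case=> -[/e1b-> [/e1-> /e2->]] /one_before_onebarP[a [s1 [s2 [s12 ->]]]] bis.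
(* The codes of bar1 1 2 sum to 2, which forces the letter inserted on the other side to be 2. *)
suff ea : two = a by move: bis; rewrite -ea; apply: separate_flank.
have := bisimilar_sum_code bis.
by rewrite (sum_code_flank _ s12) => ea; apply: code_inj; rewrite -ea !big_cons big_nil.
Qed.


(** * The converse: words with no e_i defined, then all words of length 3 *)

Lemma bisimilar_highest x y z x' y' z' :
  (forall i, e_op i [:: x; y; z] = None) ->
  bisimilar [:: x; y; z] [:: x'; y'; z'] ->
  [:: x; y; z] = [:: x'; y'; z'] \/ same_flank [:: x; y; z] [:: x'; y'; z'].
Proof.
move=> hu bis.
have hv i : e_op i [:: x'; y'; z'] = None.
  by have := bisimilar_e i bis; rewrite hu; case: (e_op i _).
have codew a b c : code_word n (code a) (code b) (code c) by split; apply: code_bound.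
have codeh a b c : (forall i, e_op i [:: a; b; c] = None) ->
    highest_code n (code a) (code b) (code c).
  move=> h k /index_of_int[i ->] e; apply/inv_codeP/(e_op_None (h i)).
  by rewrite /= orbF; case: e => [|[]] /eps_codeP ->; rewrite ?orbT.
have := highest_code_pair n_ge2 (codew x y z) (codew x' y' z') (codeh _ _ _ hu) (codeh _ _ _ hv).
have := bisimilar_sum_code bis; have := bisimilar_sum_sign bis.
rewrite !big_cons !big_nil !addr0 !addrA => -> -> /(_ erefl erefl) [].
- move=> k /index_of_int[i ->].
  have := bisimilar_inversion i bis => ei.
  by split=> /inv_codeP h; apply/inv_codeP; rewrite ?ei // -ei.
- by move=> [/code_inj-> [/code_inj-> /code_inj->]]; left.
case=> [[/one_before_onebarP[a [s1 [s2 [s12 eu]]]] /one_before_onebarP[b [t1 [t2 [t12 ev]]]]]|].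
  right; exists a, s1, s2, t1, t2; split=> //; rewrite ev.
  by rewrite (@bisimilar_flank_eq a b s1 s2 t1 t2) // -eu -ev.
by case=> /exceptional_pair_separate sep; case: sep => //; apply: bisimilar_sym.
Qed.

(** Induction on the sum of the ranks: if some e_i is defined, it is applied to both words, and the
    conclusion for the images is brought back by f_i, which undoes e_i. *)
Lemma bisimilar_size3 u v : size u = 3%N -> size v = 3%N -> bisimilar u v ->
  u = v \/ same_flank u v.
Proof.
have [m] := ubnP (sumn (map (@rank n) u)); elim: m u v => // m IHm u v.
rewrite ltnS => le_u su sv bis.
have [/existsP[i]|/existsPn hu] := boolP [exists i, e_op i u != None]; last first.
  case: u v su sv bis hu {le_u} => [|x [|y [|z [|]]]] // [|x' [|y' [|z' [|]]]] // _ _ bis hu.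
  by apply: bisimilar_highest bis => i; apply/eqP; rewrite -[_ == _]negbK.
case eu: (e_op i u) => [u'|] // _.
have := bisimilar_e i bis; rewrite eu; case ev: (e_op i v) => [v'|] //= bis'.
have fu := e_opK eu; have fv := e_opK ev.
have lt_u' : (sumn (map (@rank n) u') < m)%N by apply: leq_trans (rank_e_op eu) le_u.
case: (IHm u' v' lt_u' _ _ bis'); rewrite ?(size_e_op eu) ?(size_e_op ev) //.
  by move=> e'; left; move: fu; rewrite e' fv => -[].
move=> [a [s1 [s2 [t1 [t2 [s12 t12 du dv]]]]]]; right.
(* On both sides f_i changes the same inserted letter [a] and keeps its place. *)
move: fu fv; rewrite du dv !f_op_flank //; case: ifP => // _ [<-] [<-].
by exists (f_letter i a), s1, s2, t1, t2.
Qed.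

Lemma same_flankP x y z x' y' z' :
  same_flank [:: x; y; z] [:: x'; y'; z'] <->
  exists a : letter n,
    [:: x; y; z] \in [:: [:: a; one; onebar]; [:: one; a; onebar];
                         [:: one; onebar; a]] /\
    [:: x'; y'; z'] \in [:: [:: a; one; onebar]; [:: one; a; onebar];
                            [:: one; onebar; a]].
Proof.
have flank_mem a w s1 s2 : s1 ++ s2 = [:: one; onebar] -> w = s1 ++ a :: s2 ->
    w \in [:: [:: a; one; onebar]; [:: one; a; onebar]; [:: one; onebar; a]].
  rewrite !inE => s12 ->; case: s1 s12 => [|c [|d [|]]] //= => [->|[-> ->]|[-> -> ->]].
  - by rewrite eqxx.
  - by rewrite eqxx orbT.
  - by rewrite eqxx !orbT.
have mem_flank a w :
    w \in [:: [:: a; one; onebar]; [:: one; a; onebar]; [:: one; onebar; a]] ->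
    exists s1 s2, s1 ++ s2 = [:: one; onebar] /\ w = s1 ++ a :: s2.
  rewrite !inE => /or3P[] /eqP->.
  - by exists [::], [:: one; onebar].
  - by exists [:: one], [:: onebar].
  - by exists [:: one; onebar], [::].
split=> [[a [s1 [s2 [t1 [t2 [s12 t12 eu ev]]]]]]|].
  by exists a; split; [apply: flank_mem s12 eu|apply: flank_mem t12 ev].
case=> a [/mem_flank[s1 [s2 [s12 eu]]] /mem_flank[t1 [t2 [t12 ev]]]].
by exists a, s1, s2, t1, t2.
Qed.

End Separation.

Lemma hypoplactic_refl (n : nat) (u : word n) : hypoplactic u u.
Proof.
exists id; split=> //.
  by split=> // w uw; exists w.
by move=> w _; split=> // i; split=> //; [case: e_op|case: f_op].
Qed.

Theorem theorem9p29 (n : nat) (n_ge2 : 2 <= n) (x y z x' y' z' : letter n) :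
  let one := letter1 n_ge2 in
  let onebar := letter1bar n_ge2 in
  hypoplactic [:: x; y; z] [:: x'; y'; z'] <->
  [:: x; y; z] = [:: x'; y'; z'] \/
  exists a : letter n,
    [:: x; y; z] \in [:: [:: a; one; onebar]; [:: one; a; onebar];
                         [:: one; onebar; a]] /\
    [:: x'; y'; z'] \in [:: [:: a; one; onebar]; [:: one; a; onebar];
                            [:: one; onebar; a]].
Proof.
split=> [/hypoplactic_bisimilar bis|[->|/same_flankP]].
- have [//|//|->|fl] := bisimilar_size3 n_ge2 _ _ bis; first by left.
  by right; apply/same_flankP.
- exact: hypoplactic_refl.
- move=> [a [s1 [s2 [t1 [t2 [s12 t12 -> ->]]]]]].
  exact: hypoplactic_flank s12 t12.
Qed.
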